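(* Let $q\ge2$ and $n\ge0$ be integers and $m=\frac{q^n-1}{q-1}$. Then Euler's constant satisfies $$\gamma=\frac{A'_{n,m,q}-L'_{n,m,q}}{q^m}+\delta_{m,q}\qquad\text{with}\quad 0<\delta_{m,q}<\frac q{(2eq)^m}.$$
   Context: For real $q>1$ the $q$-logarithm is $\ln_q(1+z)=\sum_{\mu=1}^\infty \frac{(-1)^{\mu-1}z^\mu}{q^\mu-1}$ for $|z|<q$. Let $F_q(x)=1+x+\dots+x^{q-1}$ and $G_q(x)=(q-1)+(q-2)x+\dots+x^{q-2}$. For integers $m\ge0$ define integers $b_{l,m,q}$ by $$\sum_{l=0}^{m(q-1)-1}b_{l,m,q}x^l=G_q(x)\sum_{j=1}^m(-1)^j\binom mj q^{m-j}F_q(x)^{j-1}.$$ For $m\le q^{n+1}/(q-1)$ define $$L'_{n,m,q}=q^mn\log q+\sum_{l=1}^{m(q-1)-1}\frac{b_{l,m,q}}l\ln_q\Big(1+\frac l{q^n}\Big),$$ $$A'_{n,m,q}=\frac{q^m-(q-1)^m}{q^n}+q^m\Big(\sum_{\mu=1}^{q-1}\frac n\mu-\sum_{\nu=2}^n\sum_{\mu=1}^{q^{\nu-1}-1}\Big(\frac{q-1}{q\mu}-\sum_{\lambda=1}^{q-1}\frac1{q\mu+\lambda}\Big)\Big).$$ Empty sums are zero. *)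

(* Defs.v *)
From mathcomp Require Import all_boot all_order all_algebra.
From mathcomp Require Import all_classical all_reals all_analysis.

Set Implicit Arguments.
Unset Strict Implicit.
Unset Printing Implicit Defensive.

Import Order.TTheory GRing.Theory Num.Theory.
Import numFieldNormedType.Exports.

Local Open Scope ring_scope.

Definition euler_gamma (R : realType) : R :=
  limn (fun N : nat => \sum_(1 <= k < N.+1) k%:R^-1 - ln (N%:R : R)).

(* [qln q x] is ln_q(x); with z = x - 1 the series converges for `|z| < q
   (q > 1), and the value is meaningful only there. *)
Definition qln (R : realType) (q x : R) : R :=
  limn (fun N : nat =>
    \sum_(1 <= mu < N.+1)
      (-1) ^+ mu.-1 * (x - 1) ^+ mu / (q ^+ mu - 1)).

Definition Fq (q : nat) : {poly int} := \sum_(0 <= i < q) 'X^i.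

Definition Gq (q : nat) : {poly int} :=
  \sum_(0 <= i < q.-1) (q.-1 - i)%:R *: 'X^i.

Definition bpoly (m q : nat) : {poly int} :=
  Gq q * \sum_(1 <= j < m.+1)
           ((-1) ^+ j * 'C(m, j)%:R * q%:R ^+ (m - j)) *: Fq q ^+ j.-1.

Definition bcoef (l m q : nat) : int := (bpoly m q)`_l.

(* The expansion of [bpoly m q] has no term beyond l = m (q - 1) - 1. *)
Lemma bpolyE (m q : nat) :
  bpoly m q = \sum_(0 <= l < m * q.-1) bcoef l m q *: 'X^l.
Proof.
have szF : (size (Fq q) <= q.-1.+1)%N.
  rewrite /Fq big_mkord; apply: leq_trans (size_sum _ _ _) _.
  apply/bigmax_leqP => i _; rewrite size_polyXn.
  exact: leq_trans (ltn_ord i) (leqSpred _).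
have szFj j : (size (Fq q ^+ j) <= (q.-1 * j).+1)%N.
  apply: leq_trans (size_poly_exp_leq _ _) _.
  by rewrite ltnS leq_mul2r -subn1 leq_subLR add1n szF orbT.
have szG : (size (Gq q) <= q.-1)%N.
  rewrite /Gq big_mkord; apply: leq_trans (size_sum _ _ _) _.
  apply/bigmax_leqP => i _; apply: leq_trans (size_scale_leq _ _) _.
  by rewrite size_polyXn.
have szb : (size (bpoly m q) <= m * q.-1)%N.
  rewrite /bpoly mulr_sumr big_seq_cond.
  apply: leq_trans (size_sum _ _ _) _.
  apply/bigmax_leqP_seq => j jm; rewrite andbT => _.
  rewrite mem_index_iota in jm; case/andP: jm => j0 jm.
  apply: leq_trans (size_polyMleq _ _) _.
  have szj := leq_trans (size_scale_leq _ _) (szFj j.-1).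
  rewrite -subn1 leq_subLR; apply: leq_trans (leq_add szG (szj _)) _.
  rewrite addnS add1n ltnS -mulnS prednK // mulnC leq_mul2r.
  by rewrite -ltnS jm orbT.
rewrite big_mkord; under eq_bigr do rewrite /bcoef.
rewrite -poly_def; apply/polyP => i; rewrite coef_poly.
by case: ltnP => // hi; rewrite nth_default // (leq_trans szb).
Qed.

(* Intended for q >= 2 and m <= q ^ (n + 1) / (q - 1); then every l in the sum
   satisfies l / q ^ n < q, so the q-logarithms converge. *)
Definition Lprime (R : realType) (n m q : nat) : R :=
  q%:R ^+ m * n%:R * ln q%:R
  + \sum_(1 <= l < m * q.-1)
      (bcoef l m q)%:~R / l%:R * qln q%:R (1 + l%:R / q%:R ^+ n).

Definition Aprime (R : realType) (n m q : nat) : R :=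
  (q%:R ^+ m - (q%:R - 1) ^+ m) / q%:R ^+ n
  + q%:R ^+ m *
    (\sum_(1 <= mu < q) n%:R / mu%:R
     - \sum_(2 <= nu < n.+1) \sum_(1 <= mu < q ^ nu.-1)
         ((q%:R - 1) / (q%:R * mu%:R)
          - \sum_(1 <= lam < q) (q%:R * mu%:R + lam%:R)^-1)).

(* Main.v *)
(* Write F = Fq, G = Gq, so (1 - x) F = 1 - x^q and (1 - x) G = q - F.  With H_N the
   harmonic sum over k < N, the number H_(q M) - H_M - ln q is the integral of
   x^(q M - 1) G / F over [0, 1], and gamma is the sum of these over M = q^k, k >= 0;
   the first n of them give A' and the term n log q.  In the tail, the binomial theorem
   gives q^m G / F = G (q - F)^m / F - B with B the polynomial of the b_l.  Integrating B
   against x^(q^k - 1) and summing over k > n gives the first term of A' (from l = 0) and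
   the q-logarithms (from l > 0), because ln_q(1 + z) is the sum over j >= 1 of
   z / (q^j + z).  Hence delta is the sum over k > n of q^-m times the integral
   of x^(q^k - 1) G (q - F)^m / F, which is positive.  Finally
   (q - F) x^(q (q - 1)) / q <= 1 / (2 e q) bounds the k-th term by (2 e q)^-m times the
   (k - n)-th term of the series of gamma, whose partial sums are at most 1.
   The integrals only appear through explicit antiderivatives P - a ln F, with P a
   polynomial, to which the mean value theorem is applied. *)
Require Import Defs.
From mathcomp Require Import all_boot all_order all_algebra.
From mathcomp Require Import all_classical all_reals all_analysis.
From mathcomp Require Import ring lra zify.

Import Order.TTheory GRing.Theory Num.Theory.
Import numFieldNormedType.Exports.

Local Open Scope ring_scope.

(** * Integer polynomial identities, and the mean value theorem for [P - a ln F] *)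

Lemma Fq_telescope (q : nat) : (1 - 'X) * Fq q = 1 - 'X^q.
Proof. by rewrite /Fq big_mkord -opprB -[RHS]opprB subrX1 mulNr. Qed.

Lemma Gq_telescope (q : nat) : (0 < q)%N -> (1 - 'X) * Gq q = q%:R - Fq q.
Proof.
case: q => // p _; elim: p => [|p IHp].
  by rewrite /Gq /Fq /= big_nil big_nat1 expr0 mulr0 subrr.
have -> : Gq p.+2 = Gq p.+1 + Fq p.+1.
  rewrite /Gq /Fq /= [X in _ + X]big_nat_recr //= addrA -big_split /=.
  rewrite big_nat_recr //= subSnn scale1r; congr (_ + _).
  apply: eq_big_nat => i /andP[_ ip].
  by rewrite subSn 1?ltnW // -natr1 scalerDl scale1r.
rewrite mulrDr IHp Fq_telescope [Fq p.+2]/Fq big_nat_recr //= -/(Fq p.+1).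
by rewrite -[in RHS]natr1; ring.
Qed.

(** In the binomial expansion of $(q-F)^m$ only the term $j=0$, equal to $q^m$, lacks a factor $F$;
    [bpoly] is $G$ times what is left of the others after dividing out $F$. *)
Lemma bpoly_binomial (m q : nat) :
  q%:R ^+ m * Gq q + Fq q * bpoly m q = Gq q * (q%:R - Fq q) ^+ m.
Proof.
rewrite exprDn big_ord_recl /= subn0 expr0 mulr1 bin0 mulr1n mulrDr [Gq q * _]mulrC.
congr (_ + _); rewrite /bpoly big_add1 /= big_mkord mulrCA mulr_sumr.
congr (_ * _); apply: eq_bigr => i _; rewrite /bump /= add1n.
rewrite -mul_polyC !rmorphM !rmorphXn !rmorphN1 !rmorph_nat
  (exprNn (Fq q)) (exprS (Fq q)) -[RHS]mulr_natr; ring.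
Qed.

(** Stands in for integration: a sign of the derivative on the open interval passes to the increment
    over $[0,1]$. That [c] is interior keeps strict inequalities available. *)
Lemma poly_ln_MVT {R : realType} (P F : {poly R}) (a : R) :
  (forall x, 0 <= x <= 1 -> 0 < F.[x]) ->
  exists2 c, 0 < c < 1 &
    P.[1] - a * ln F.[1] - (P.[0] - a * ln F.[0]) = P^`().[c] - a * (F^`().[c] / F.[c]).
Proof.
move=> F0; pose f : R -> R := horner P - a *: (@ln R \o horner F).
have fd (x : R) : 0 <= x <= 1 -> is_derive x 1 f (P^`().[x] - a * (F^`().[x] / F.[x])).
  move=> x01; have Fx := F0 _ x01.
  have dln : is_derive x 1 (@ln R \o horner F) (F^`().[x] / F.[x]).
    by rewrite mulrC; apply: is_derive1_comp; exact: is_derive1_ln.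
  exact: is_deriveB.
have [||c] := @MVT R f (fun x => P^`().[x] - a * (F^`().[x] / F.[x])) 0 1 ltr01.
- by move=> x; rewrite in_itv /= => /andP[x0 x1]; apply: fd; rewrite !ltW.
- apply: derivable_within_continuous => x; rewrite in_itv /= => x01.
  by have [] := fd _ x01.
by rewrite in_itv /= => c01; rewrite subr0 mulr1 => fE; exists c.
Qed.

(** * The antiderivative before correction *)

Definition FqR (R : realType) (q : nat) : {poly R} := map_poly intr (Fq q).
Definition GqR (R : realType) (q : nat) : {poly R} := map_poly intr (Gq q).

Lemma FqR_telescope {R : realType} q : (1 - 'X) * FqR R q = 1 - 'X^q.
Proof.
have := congr1 (map_poly (intr : int -> R)) (Fq_telescope q).
by rewrite rmorphM !rmorphB rmorph1 /= map_polyX map_polyXn.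
Qed.

Lemma GqR_telescope {R : realType} q : (0 < q)%N ->
  (1 - 'X) * GqR R q = q%:R - FqR R q.
Proof.
move=> q0; have := congr1 (map_poly (intr : int -> R)) (Gq_telescope q q0).
by rewrite rmorphM !rmorphB rmorph1 /= map_polyX rmorph_nat.
Qed.

(* [antider q M - ln Fq] is an antiderivative of [x ^ (q M - 1) Gq / Fq]. *)
Definition antider (R : realType) (q M : nat) : {poly R} :=
  \sum_(1 <= i < q * M) i%:R^-1 *: 'X^i - \sum_(1 <= i < M) i%:R^-1 *: 'X^(q * i).

(** Clearing the denominator $F$ keeps the identity polynomial. After multiplication by $1-X$ both
    sums become geometric, and both sides reduce to $X^{qM-1}(q-F)$. *)
Lemma deriv_antider {R : realType} q M : (0 < q)%N -> (0 < M)%N ->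
  (antider R q M)^`() * FqR R q - (FqR R q)^`() = 'X^((q * M).-1) * GqR R q.
Proof.
move=> q0 M0; have qM0 : (0 < q * M)%N by rewrite muln_gt0 q0.
have X1 : (1 - 'X : {poly R}) != 0 by rewrite -opprB oppr_eq0 polyXsubC_eq0.
(* This is the derivative of $(1-X)F=1-X^q$. *)
have dF : (1 - 'X) * (FqR R q)^`() = FqR R q - 'X^(q.-1) *+ q.
  have /(congr1 (@deriv R)) := @FqR_telescope R q.
  rewrite derivM !derivB derivX derivC derivXn => /eqP.
  by rewrite !sub0r mulN1r addrC subr_eq => /eqP ->; rewrite addrC.
have dA : (antider R q M)^`() =
    \sum_(0 <= i < (q * M).-1) 'X^i - (\sum_(1 <= i < M) 'X^((q * i).-1)) *+ q.
  rewrite /antider derivB !raddf_sum /= big_add1 -sumrMnl.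
  rewrite -[in RHS]sumrN; congr (_ + _); apply: eq_big_nat => i.
    by rewrite derivZ derivXn -scalerMnr scalerMnl -[_^-1 *+ _]mulr_natr mulVf
      ?scale1r // pnatr_eq0.
  move=> /andP[i0 _]; congr (- _); rewrite derivZ derivXn -scalerMnr scalerMnl.
  rewrite mulnC -[_^-1 *+ _]mulr_natr natrM mulrA mulVf ?mul1r ?scaler_nat //.
  by rewrite pnatr_eq0 -lt0n.
have tele : (1 - 'X^q) * \sum_(1 <= i < M) 'X^((q * i).-1)
          = 'X^(q.-1) - 'X^((q * M).-1) :> {poly R}.
  elim: M M0 {qM0 dA} => // -[|M] IHM _; first by rewrite big_geq // mulr0 muln1 subrr.
  rewrite big_nat_recr //= mulrDr IHM // mulrBl mul1r -exprD addnC.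
  have -> : ((q * M.+1).-1 + q = (q * M.+2).-1)%N by nia.
  by ring.
have geo : (1 - 'X) * \sum_(0 <= i < (q * M).-1) 'X^i = 1 - 'X^((q * M).-1) :> {poly R}.
  by rewrite big_mkord -opprB mulNr -subrX1 opprB.
apply: (mulfI X1); rewrite dA.
set S := \sum_(0 <= i < _) _ in geo *; set T := \sum_(1 <= i < M) _ in tele *.
set F := FqR R q in dF *; set K := 'X^((q * M).-1) in geo tele *.
transitivity ((1 - 'X) * S * F - q%:R * T * ((1 - 'X) * F) - (1 - 'X) * F^`()).
  by rewrite -mulr_natl; ring.
rewrite geo dF FqR_telescope mulrCA GqR_telescope // -/F -mulrA [T * _]mulrC tele.
by rewrite -mulr_natl; ring.
Qed.

(** * Values and bounds of $F$ and $G$ on the unit interval *)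

Lemma FqR_horner {R : realType} q (x : R) : (FqR R q).[x] = \sum_(0 <= i < q) x ^+ i.
Proof.
rewrite /FqR /Fq rmorph_sum horner_sum; apply: eq_bigr => i _.
by rewrite /= map_polyXn hornerXn.
Qed.

Lemma FqR_gt0 {R : realType} q (x : R) : (0 < q)%N -> 0 <= x -> 0 < (FqR R q).[x].
Proof.
case: q => // q _ x0; rewrite FqR_horner big_nat_recl // expr0.
by rewrite ltr_wpDr // sumr_ge0 // => i _; exact: exprn_ge0.
Qed.

Lemma FqR1 {R : realType} q : (FqR R q).[1] = q%:R.
Proof.
rewrite FqR_horner big_mkord (eq_bigr (fun=> 1)) => [|i _]; last exact: expr1n.
by rewrite sumr_const card_ord.
Qed.

Lemma FqR0 {R : realType} q : (0 < q)%N -> (FqR R q).[0] = 1.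
Proof.
case: q => // q _; rewrite FqR_horner big_nat_recl // expr0.
by rewrite big1 ?addr0 // => i _; rewrite expr0n.
Qed.

(** Bernoulli's inequality $1-x^i\le i(1-x)$, summed over $i<q$; doubling avoids halving
    $q(q-1)$. *)
Lemma natr_sub_FqR_le {R : realType} q (x : R) : 0 <= x <= 1 ->
  (q%:R - (FqR R q).[x]) *+ 2 <= (q * q.-1)%:R * (1 - x).
Proof.
move=> /andP[x0 x1]; rewrite FqR_horner.
have x1' : 0 <= 1 - x by rewrite subr_ge0.
have bern i : 1 - x ^+ i <= i%:R * (1 - x).
  elim: i => [|i IHi]; first by rewrite expr0 subrr mul0r.
  have := exprn_ile1 i x0 x1; have := exprn_ge0 i x0.
  rewrite exprS -natr1; move: IHi; set y := x ^+ i; set k := i%:R => h1 h2 h3.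
  nra.
elim: q => [|q IHq]; first by rewrite big_nil subrr mul0rn mul0r.
rewrite big_nat_recr //= -natr1 opprD addrACA mulrnDl.
have -> : (q.+1 * q)%:R * (1 - x) = (q * q.-1)%:R * (1 - x) + (q%:R * (1 - x)) *+ 2.
  have -> : (q.+1 * q = q * q.-1 + q * 2)%N by case: (q) => //= p; nia.
  by rewrite natrD (natrM _ q 2); ring.
by rewrite lerD // lerMn2r bern.
Qed.

Lemma natr_sub_FqR_gt0 {R : realType} q (x : R) : (1 < q)%N -> 0 <= x < 1 ->
  0 < q%:R - (FqR R q).[x].
Proof.
case: q => // -[|q] // _ /andP[x0 x1].
rewrite FqR_horner subr_gt0 big_nat_recl // expr0 -natr1 addrC ltrD2r.
have -> : q.+1%:R = \sum_(0 <= i < q.+1) 1 :> R by rewrite big_mkord sumr_const card_ord.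
by apply: ltr_sum_nat => // i _; rewrite exprn_ilt1.
Qed.

Lemma GqR_gt0 {R : realType} q (x : R) : (1 < q)%N -> 0 <= x < 1 -> 0 < (GqR R q).[x].
Proof.
move=> q1 x01; have := natr_sub_FqR_gt0 q x q1 x01.
have /(congr1 (horner^~ x)) := @GqR_telescope R q (ltnW q1).
rewrite -polyC_natr !hornerE /= => <-; rewrite pmulr_rgt0 // subr_gt0.
by case/andP: x01.
Qed.

(** With $t=a(1-x)$ and $x\le1$, multiply $x^a\le e^{-t}$ by $t\le e^{t-1}$. For $x>1$ the left side
    is not positive. *)
Lemma exprn_mul_1B_le {R : realType} a (x : R) : 0 <= x ->
  a%:R * (1 - x) * x ^+ a <= expR (-1).
Proof.
move=> x0; have [x1|x1] := lerP x 1; last first.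
  rewrite (le_trans _ (expR_ge0 _)) // mulr_le0_ge0 ?exprn_ge0 //.
  by rewrite mulr_ge0_le0 // subr_le0 ltW.
have xe : x ^+ a <= expR (- (a%:R * (1 - x))).
  rewrite -mulrN expRM_natl lerXn2r ?nnegrE ?expR_ge0 //.
  by have := expR_ge1Dx (- (1 - x)); rewrite opprB addrC subrK.
have te : a%:R * (1 - x) <= expR (a%:R * (1 - x) - 1).
  by have := expR_ge1Dx (a%:R * (1 - x) - 1); rewrite addrC subrK.
have -> : expR (-1) = expR (a%:R * (1 - x) - 1) * expR (- (a%:R * (1 - x))) :> R.
  by rewrite -expRD addrAC subrr sub0r.
by rewrite ler_pM ?exprn_ge0 // mulr_ge0 // subr_ge0.
Qed.

(** Source of the constant $2eq$: the $2$ comes from [natr_sub_FqR_le], the $e$ from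
    [exprn_mul_1B_le] with $a=q(q-1)$. *)
Lemma natr_sub_FqR_expr_le {R : realType} q (x : R) : (0 < q)%N -> 0 <= x <= 1 ->
  q%:R^-1 * (q%:R - (FqR R q).[x]) * x ^+ (q * q.-1) <= (2 * expR 1 * q%:R)^-1.
Proof.
move=> q0 x01; have /andP[x0 x1] := x01.
have q0' : 0 < q%:R :> R by rewrite ltr0n.
have h1 := natr_sub_FqR_le q x x01.
have h2 := exprn_mul_1B_le (q * q.-1) x x0.
have -> : (2 * expR 1 * q%:R)^-1 = q%:R^-1 * (2^-1 * expR (-1)) :> R.
  by rewrite !invfM expRN mulrC mulrA.
rewrite -mulrA ler_pM2l ?invr_gt0 // ler_pdivlMl //; apply: (le_trans _ h2).
by rewrite mulrA ler_wpM2r ?exprn_ge0 // [2 * _]mulr_natl.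
Qed.

(** * The corrected antiderivative: derivative, positivity and upper bound *)

(* The integral of [x ^ (q M - 1) Gq / Fq] over [0, 1]. *)
Definition antider_ln (R : realType) q M : R := (antider R q M).[1] - ln q%:R.

(* [corrected m q M - ln Fq] is an antiderivative of
   [q ^- m x ^ (q M - 1) Gq (q - Fq) ^ m / Fq]. *)
Definition corrected (R : realType) m q M : {poly R} :=
  antider R q M + q%:R ^- m *:
    \sum_(0 <= l < m * q.-1) ((bcoef l m q)%:~R / (q * M + l)%:R) *: 'X^(q * M + l).

(** The added sum has derivative $q^{-m}X^{qM-1}B$ with $B$ the polynomial [bpoly], and
    [bpoly_binomial] merges $G+q^{-m}FB$ into $q^{-m}G(q-F)^m$. *)
Lemma deriv_corrected {R : realType} m q M : (0 < q)%N -> (0 < M)%N ->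
  (corrected R m q M)^`() * FqR R q - (FqR R q)^`() =
  q%:R ^- m *: ('X^((q * M).-1) * GqR R q * (q%:R - FqR R q) ^+ m).
Proof.
move=> q0 M0; have qM0 : (0 < q * M)%N by rewrite muln_gt0 q0.
have qm0 : q%:R ^+ m != 0 :> R by rewrite expf_neq0 // pnatr_eq0 -lt0n.
have -> : (corrected R m q M)^`() = (antider R q M)^`() +
    q%:R ^- m *: ('X^((q * M).-1) * map_poly intr (bpoly m q)).
  rewrite derivD derivZ raddf_sum [in RHS]bpolyE rmorph_sum mulr_sumr.
  congr (_ + _ *: _); apply: eq_bigr => l _ /=.
  rewrite derivZ derivXn map_polyZ /= map_polyXn -scalerMnr scalerMnl -scalerAr -exprD.
  rewrite -[_ / _ *+ _]mulr_natr divfK ?pnatr_eq0 ?addn_eq0 -?lt0n ?negb_and -?lt0n ?qM0 //.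
  by rewrite -[in LHS](prednK qM0).
rewrite mulrDl addrAC deriv_antider //.
have /(congr1 (map_poly (intr : int -> R))) := bpoly_binomial m q.
rewrite !(rmorphD, rmorphM, rmorphXn, rmorphN, rmorph_nat) /= -/(FqR R q) -/(GqR R q).
move=> binom; rewrite -[in RHS]mulrA -binom -!mul_polyC.
have cq : (q%:R ^- m)%:P * q%:R ^+ m = 1 :> {poly R}.
  by rewrite -polyC_natr -polyC_exp -polyCM mulVf.
rewrite mulrDr mulrDr [X in _ = X + _]mulrCA [_%:P * (_ * GqR R q)]mulrA cq mul1r.
by congr (_ + _); ring.
Qed.

Lemma corrected1 {R : realType} m q M : (corrected R m q M).[1] - ln q%:R =
  antider_ln R q M + q%:R ^- m * \sum_(0 <= l < m * q.-1)
    (bcoef l m q)%:~R / (q * M + l)%:R.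
Proof.
rewrite /corrected /antider_ln hornerD hornerZ horner_sum addrAC; congr (_ + _ * _).
by apply: eq_bigr => l _; rewrite hornerZ hornerXn expr1n mulr1.
Qed.

Lemma antider0 {R : realType} q M : (0 < q)%N -> (antider R q M).[0] = 0.
Proof.
move=> q0; rewrite /antider hornerD hornerN !horner_sum !big_nat !big1 ?subrr //.
  by move=> i /andP[i0 _]; rewrite hornerZ hornerXn expr0n eqn0Ngt muln_gt0 q0 i0 mulr0.
by move=> i /andP[i0 _]; rewrite hornerZ hornerXn expr0n eqn0Ngt i0 mulr0.
Qed.

Lemma corrected0 {R : realType} m q M : (0 < q)%N -> (0 < M)%N ->
  (corrected R m q M).[0] = 0.
Proof.
move=> q0 M0; rewrite /corrected hornerD hornerZ antider0 // add0r.
rewrite horner_sum big1 ?mulr0 // => i _.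
by rewrite hornerZ hornerXn expr0n eqn0Ngt addn_gt0 muln_gt0 q0 M0 mulr0.
Qed.

Lemma corrected_gt0 {R : realType} m q M : (1 < q)%N -> (0 < M)%N ->
  0 < (corrected R m q M).[1] - ln q%:R.
Proof.
move=> q1 M0; have q0 := ltnW q1.
have [|c c01] := @poly_ln_MVT R (corrected R m q M) (FqR R q) 1.
  by move=> x /andP[x0 _]; exact: FqR_gt0.
have /andP[c0 c1] := c01; have Fc := FqR_gt0 q c q0 (ltW c0).
rewrite corrected0 // FqR1 FqR0 // ln1 !mul1r !subr0 => ->.
(* Over the common denominator $F$ the numerator is the left side of [deriv_corrected]. *)
rewrite -[X in X - _](mulfK (lt0r_neq0 Fc)) -mulrBl divr_gt0 //.
rewrite -hornerM -hornerN -hornerD deriv_corrected //.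
rewrite hornerZ !hornerM hornerXn horner_exp -polyC_natr hornerD hornerN hornerC.
rewrite mulr_gt0 ?invr_gt0 ?exprn_gt0 ?ltr0n // mulr_gt0 //.
  by rewrite mulr_gt0 ?exprn_gt0 // GqR_gt0 // ltW.
by rewrite exprn_gt0 // natr_sub_FqR_gt0 // ltW.
Qed.

(** The integrands are compared pointwise: enough powers of $x$ are split off to apply
    [natr_sub_FqR_expr_le] to each of the $m$ factors $q-F$. *)
Lemma corrected_le {R : realType} m n q j : (1 < q)%N -> (m * q.-1 = (q ^ n).-1)%N ->
  (corrected R m q (q ^ (n + j))).[1] - ln q%:R <=
  (2 * expR 1 * q%:R) ^- m * antider_ln R q (q ^ j).
Proof.
move=> q1 mq; have q0 := ltnW q1.
set c := (2 * expR 1 * q%:R) ^- m; set C := corrected _ _ _ _.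
have M0 k : (0 < q ^ k)%N by rewrite expn_gt0 q0.
(* The coefficient $c-1$ arises from $c(A-\ln F)-(C-\ln F)$, where $A$ is the antiderivative at
   $q^j$. *)
have [|x x01] := @poly_ln_MVT R (c *: antider R q (q ^ j) - C) (FqR R q) (c - 1).
  by move=> x /andP[x0 _]; exact: FqR_gt0.
have /andP[x0 x1] := x01; have Fx := FqR_gt0 q x q0 (ltW x0).
rewrite derivB derivZ !(hornerD (c *: _)) !(hornerN C) (hornerN C^`()) !(hornerZ c).
rewrite antider0 // corrected0 //.
rewrite FqR1 FqR0 // ln1 /antider_ln => E; rewrite -subr_ge0.
have -> : c * ((antider R q (q ^ j)).[1] - ln q%:R) - (C.[1] - ln q%:R) =
  c * (antider R q (q ^ j)).[1] - C.[1] - (c - 1) * ln q%:R - (c * 0 - 0 - (c - 1) * 0).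
  by ring.
rewrite {}E.
have -> : c * ((antider R q (q ^ j))^`()).[x] - (C^`()).[x]
    - (c - 1) * ((FqR R q)^`().[x] / (FqR R q).[x]) =
  (c * ((antider R q (q ^ j))^`() * FqR R q - (FqR R q)^`()).[x]
   - (C^`() * FqR R q - (FqR R q)^`()).[x]) / (FqR R q).[x].
  by rewrite !hornerD !hornerN !hornerM; field; exact: lt0r_neq0.
rewrite divr_ge0 ?(ltW Fx) // subr_ge0 deriv_corrected // deriv_antider //.
rewrite !(hornerZ, hornerM, hornerXn, horner_exp) -polyC_natr hornerD hornerN hornerC.
set F := (FqR R q).[x]; set G := (GqR R q).[x].
have G0 : 0 < G by rewrite GqR_gt0 // ltW.
have qF : 0 < q%:R - F by rewrite natr_sub_FqR_gt0 // ltW.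
(* As $m(q-1)=q^n-1$, the right side exceeds the left by $q(q^n-1)(q^j-1)$. *)
have exps : (q * q.-1 * m + (q * q ^ j).-1 <= (q * q ^ (n + j)).-1)%N.
  have := M0 n; have := M0 j; rewrite expnD -mulnA [(q.-1 * m)%N]mulnC mq.
  by move: (q ^ n)%N (q ^ j)%N => [|u] [|v] //=; nia.
have le1 := natr_sub_FqR_expr_le q x q0 (introT andP (conj (ltW x0) (ltW x1))).
have le2 : (q%:R^-1 * (q%:R - F) * x ^+ (q * q.-1)) ^+ m <= c.
  have q0' : 0 <= q%:R^-1 :> R by rewrite invr_ge0.
  rewrite /c -exprVn lerXn2r ?nnegrE ?invr_ge0 ?mulr_ge0 ?expR_ge0 ?exprn_ge0 //;
    exact: ltW.
have le3 : x ^+ (q * q ^ (n + j)).-1 <= (x ^+ (q * q.-1)) ^+ m * x ^+ (q * q ^ j).-1.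
  by rewrite -exprM -exprD ler_wiXn2l // ltW.
move: le2 le3; rewrite !exprMn exprVn.
set D := (q%:R - F) ^+ m; set Z := x ^+ (q * q ^ j).-1; set Y := (x ^+ _) ^+ m.
set X := x ^+ _ => le2 le3.
have G0' := ltW G0; have D0 : 0 <= D by rewrite exprn_ge0 // ltW.
have qm0 : 0 <= q%:R ^- m :> R by rewrite invr_ge0 exprn_ge0.
have Z0 : 0 <= Z by rewrite exprn_ge0 // ltW.
apply: (@le_trans _ _ (q%:R ^- m * D * Y * (Z * G))); last first.
  by rewrite ler_wpM2r // mulr_ge0.
have -> : q%:R ^- m * (X * G * D) = (q%:R ^- m * D * G) * X by ring.
have -> : q%:R ^- m * D * Y * (Z * G) = (q%:R ^- m * D * G) * (Y * Z) by ring.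
by rewrite ler_wpM2l // !mulr_ge0.
Qed.

(** * Harmonic sums and Euler's constant *)

Local Open Scope classical_set_scope.

(* [H_(N - 1)] in the usual notation. *)
Definition harm (R : realType) (N : nat) : R := \sum_(1 <= k < N) k%:R^-1.

Lemma harmS {R : realType} N : (0 < N)%N -> harm R N.+1 = harm R N + N%:R^-1.
Proof. by move=> N0; rewrite /harm big_nat_recr. Qed.

(** Both bounds are $\ln(1+t)\le t$, at $t=-1/(N+1)$ and at $t=1/N$. *)
Lemma ln_succ_sub_bounds {R : realType} N : (0 < N)%N ->
  N.+1%:R^-1 <= ln N.+1%:R - ln (N%:R : R) <= N%:R^-1.
Proof.
move=> N0; have p0 : 0 < N%:R :> R by rewrite ltr0n.
have p1 : 0 < N.+1%:R :> R by rewrite ltr0n.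
apply/andP; split.
  rewrite -[leRHS]opprB -ln_div ?posrE // lerNr.
  have -> : N%:R / N.+1%:R = 1 + - N.+1%:R^-1 :> R.
    by rewrite -[N%:R](addrK 1) natr1 mulrBl divff ?gt_eqF // mul1r.
  by rewrite le_ln1Dx // ltrN2 invf_lt1 // ltr1n ltnS.
rewrite -ln_div ?posrE //.
have -> : N.+1%:R / N%:R = 1 + N%:R^-1 :> R.
  by rewrite -natr1 mulrDl divff ?gt_eqF // mul1r.
by rewrite le_ln1Dx // (@lt_trans _ _ 0) ?invr_gt0 // ltrN10.
Qed.

(** The shift skips $N=0$, where the convention $\ln 0=0$ gives the value $0$, below the value $1$
    at $N=1$. *)
Lemma harm_sub_ln_nonincreasing {R : realType} :
  nonincreasing_seq (fun N => harm R N.+2 - ln N.+1%:R).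
Proof.
apply/nonincreasing_seqP => N; rewrite (harmS N.+2) //.
have /andP[+ _] := @ln_succ_sub_bounds R N.+1 isT.
by move: _^-1 (ln _) (ln _) (harm _ _) => a b c d; lra.
Qed.

Lemma ln_le_harm {R : realType} N : (0 < N)%N -> ln N%:R <= harm R N.
Proof.
elim: N => // -[|N] IHN _; first by rewrite ln1 /harm big_geq.
rewrite harmS //; have /andP[_] := @ln_succ_sub_bounds R N.+1 isT.
have := IHN isT; move: _^-1 (ln _) (ln _) (harm _ _) => a b c d; lra.
Qed.

(** A [limn] is a limit only once convergence is known; here the sequence is nonincreasing and
    bounded below by $0$. *)
Lemma euler_gamma_cvg {R : realType} :
  (fun N => harm R N.+1 - ln N%:R) @ \oo --> euler_gamma R.
Proof.
have c : cvgn (fun N => harm R N.+2 - ln N.+1%:R).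
  apply: nonincreasing_is_cvgn; first exact: harm_sub_ln_nonincreasing.
  exists 0 => _ [N _ <-]; rewrite subr_ge0 harmS //.
  by rewrite (le_trans (ln_le_harm N.+1 isT)) // lerDl invr_ge0.
have [l cl] := (cvg_ex _).1 c.
have cl' : (fun N => harm R N.+1 - ln N%:R) @ \oo --> l by rewrite -cvg_shiftS.
exact: cvgP cl'.
Qed.

Lemma harm_sub_ln_le1 {R : realType} N : (0 < N)%N -> harm R N - ln N%:R <= 1.
Proof.
case: N => // N _.
have h : harm R N.+2 - ln N.+1%:R <= harm R 2 - ln 1.
  exact: (@harm_sub_ln_nonincreasing R 0%N N).
move: h; rewrite [harm R 2]/harm big_nat1 ln1 invr1 harmS // => h.
have : 0 <= N.+1%:R^-1 :> R by rewrite invr_ge0.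
by move: h; move: _^-1 (ln _) (harm _ _) => a b c; lra.
Qed.

Lemma cvg_expn_ninfty q : (1 < q)%N -> (expn q) @ \oo --> \oo.
Proof.
move=> q1; apply/cvgnyPge => A; exists A => // n /= An.
by rewrite (leq_trans An) // ltnW // ltn_expl.
Qed.

Lemma harm_expn_cvg {R : realType} q n : (1 < q)%N ->
  (fun J => harm R (q ^ (n + J)) - J%:R * ln q%:R) @ \oo -->
    euler_gamma R + n%:R * ln q%:R.
Proof.
move=> q1; have q0 := ltnW q1.
have h1 : (fun J => harm R (q ^ J).+1 - ln (q ^ J)%:R) @ \oo --> euler_gamma R.
  exact: cvg_comp (cvg_expn_ninfty q q1) euler_gamma_cvg.
(* This is the last term $1/q^J$, by which the harmonic sums in [h1] and [h3] differ. *)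
have h2 : (fun J => q%:R^-1 ^+ J : R) @ \oo --> (0 : R).
  by apply: cvg_expr; rewrite ger0_norm ?invr_ge0 // invf_lt1 ?ltr1n ?ltr0n.
have h3 : (fun J => harm R (q ^ J) - J%:R * ln q%:R) @ \oo --> euler_gamma R.
  rewrite -[euler_gamma R]subr0; apply: cvg_trans (cvgB h1 h2).
  apply: near_eq_cvg; apply: nearW => J /=.
  by rewrite !fctE harmS ?expn_gt0 ?q0 // natrX lnXn ?ltr0n // exprVn mulr_natl; ring.
have := h3; rewrite -(cvg_shiftn n) => h4.
apply: cvg_trans (cvgD h4 (cvg_cst (n%:R * ln q%:R : R))).
apply: near_eq_cvg; apply: nearW => J /=.
by rewrite !fctE /cst addnC natrD; ring.
Qed.

(** * The $q$-logarithm as a sum of reciprocals *)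

Definition qln_term (R : realType) (q z : R) (k : nat) : R :=
  (-1) ^+ k * z ^+ k.+1 / (q ^+ k.+1 - 1).

Lemma qlnE {R : realType} (q z : R) : qln q (1 + z) = limn (series (qln_term R q z)).
Proof.
rewrite /qln; congr (lim (_ @ \oo)); apply/funext => N.
rewrite /series /= big_add1 /=; apply: eq_bigr => k _.
by rewrite /qln_term addrC addKr.
Qed.

(** For $q\ge2$ every denominator is at least $1$. The resulting geometric majorant asks for $z<1$,
    which holds for $z=l/q^n$ with $l<q^n$. *)
Lemma qln_term_le {R : realType} (q z : R) k : 2 <= q -> 0 <= z ->
  `|qln_term R q z k| <= geometric z z k.
Proof.
move=> q2 z0; rewrite /qln_term /geometric /= !normrM normrX normrN1 expr1n mul1r.
rewrite normfV ger0_norm ?exprn_ge0 // -exprS.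
have q1 : 1 <= q ^+ k.+1 - 1.
  have : 2 ^+ k.+1 <= q ^+ k.+1 by rewrite lerXn2r ?nnegrE ?(le_trans _ q2).
  have : 2 <= 2 ^+ k.+1 :> R by rewrite exprS ler_peMr // exprn_ege1 // ler1n.
  by move: (2 ^+ _) (q ^+ _) => a b; lra.
rewrite ger0_norm ?(le_trans _ q1) //.
by rewrite ler_piMr ?exprn_ge0 // invf_le1 // (lt_le_trans _ q1).
Qed.

Lemma qln_term_norm_cvg {R : realType} (q z : R) : 2 <= q -> 0 <= z < 1 ->
  cvgn [normed series (qln_term R q z)].
Proof.
move=> q2 /andP[z0 z1]; apply: (@series_le_cvg _ _ (geometric z z)).
- by move=> k; exact: normr_ge0.
- by move=> k; rewrite /= mulr_ge0 ?exprn_ge0.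
- by move=> k; exact: qln_term_le.
- by apply: is_cvg_geometric_series; rewrite ger0_norm.
Qed.

Lemma qln_norm_le {R : realType} (q z : R) : 2 <= q -> 0 <= z < 1 ->
  `|qln q (1 + z)| <= z / (1 - z).
Proof.
move=> q2 z01; have c := qln_term_norm_cvg q z q2 z01; have /andP[z0 z1] := z01.
have nz : `|z| < 1 by rewrite ger0_norm.
rewrite qlnE (le_trans (lim_series_norm c)) //.
rewrite -(cvg_lim _ (@cvg_geometric_series _ z z nz)) //.
apply: lim_series_le => //; first exact: is_cvg_geometric_series.
by move=> k; exact: qln_term_le.
Qed.

(** Replacing $z$ by $z/q$ divides the term of index $\mu$ by $q^\mu$, so the difference loses its
    denominators $q^\mu-1$ and is a geometric series of ratio $-z/q$. *)
Lemma qln_rec {R : realType} (q z : R) : 2 <= q -> 0 <= z < 1 ->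
  qln q (1 + z) = qln q (1 + z / q) + z / (q + z).
Proof.
move=> q2 z01; have /andP[z0 z1] := z01.
have q0 : 0 < q by rewrite (lt_le_trans _ q2).
have zq01 : 0 <= z / q < 1.
  rewrite divr_ge0 ?(ltW q0) //= ltr_pdivrMr // mul1r (lt_trans z1) //.
  by rewrite (lt_le_trans _ q2) // ltr1n.
have c1 := normed_cvg (qln_term_norm_cvg q z q2 z01).
have c2 := normed_cvg (qln_term_norm_cvg q (z / q) q2 zq01).
have nz : `|- (z / q)| < 1 by rewrite normrN ger0_norm; case/andP: zq01.
have c3 := @cvg_geometric_series _ (z / q) _ nz.
rewrite -[LHS](subrK (qln q (1 + z / q))) [RHS]addrC; congr (_ + _); rewrite !qlnE -limB //.
have -> : series (qln_term R q z) - series (qln_term R q (z / q)) =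
    series (geometric (z / q) (- (z / q))).
  apply/funext => N; rewrite !fctE /series /= -sumrB; apply: eq_bigr => k _.
  rewrite /qln_term /= (exprNn (z / q)) mulrCA -exprS -!mulrA -mulrBr; congr (_ * _).
  have qk : 1 < q ^+ k.+1 by rewrite exprn_egt1 // (lt_le_trans _ q2) // ltr1n.
  rewrite expr_div_n; field.
  by rewrite subr_eq0 !gt_eqF // (lt_trans _ qk).
rewrite (cvg_lim _ c3) //; field.
by rewrite !gt_eqF // ltr_pwDl.
Qed.

Lemma qln_sum {R : realType} (q z : R) J : 2 <= q -> 0 <= z < 1 ->
  qln q (1 + z) = qln q (1 + z / q ^+ J) + \sum_(0 <= j < J) z / (q ^+ j.+1 + z).
Proof.
move=> q2 z01; have /andP[z0 z1] := z01.
have q1 : 1 < q by rewrite (lt_le_trans _ q2) // ltr1n.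
have q0 : 0 < q by rewrite (lt_trans _ q1).
elim: J => [|J ->]; first by rewrite expr0 divr1 big_nil addr0.
have qJ : 1 <= q ^+ J by rewrite exprn_ege1 // ltW.
have qJ0 : 0 < q ^+ J by rewrite exprn_gt0.
have zJ : 0 <= z / q ^+ J < 1.
  by rewrite divr_ge0 ?(ltW qJ0) //= ltr_pdivrMr // mul1r (lt_le_trans z1).
rewrite qln_rec // big_nat_recr //= addrAC -addrA; congr (_ + _).
  by rewrite exprSr invfM mulrA.
congr (_ + _); rewrite exprS; field.
by rewrite !gt_eqF // ?ltr_pwDl // mulr_gt0.
Qed.

(** The remainder $\ln_q(1+z/q^J)$ in [qln_sum] is at most $\frac{z}{1-z}q^{-J}$. *)
Lemma qln_cvg {R : realType} (q z : R) : 2 <= q -> 0 <= z < 1 ->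
  (fun J => \sum_(0 <= j < J) z / (q ^+ j.+1 + z)) @ \oo --> qln q (1 + z).
Proof.
move=> q2 z01; have /andP[z0 z1] := z01.
have q1 : 1 < q by rewrite (lt_le_trans _ q2) // ltr1n.
have q0 : 0 < q by rewrite (lt_trans _ q1).
have h : (fun J => z / (1 - z) * q^-1 ^+ J) @ \oo --> (0 : R).
  rewrite -[0](mulr0 (z / (1 - z))); apply: cvgMr; apply: cvg_expr.
  by rewrite ger0_norm ?invr_ge0 ?(ltW q0) // invf_lt1.
apply/subr_cvg0/norm_cvg0P; apply: (squeeze_cvgr _ (cvg_cst 0) h).
apply: nearW => J; rewrite normr_ge0 /= (qln_sum q z J q2 z01) distrC addrK.
have qJ : 1 <= q ^+ J by rewrite exprn_ege1 // ltW.
have qJ0 : 0 < q ^+ J by rewrite exprn_gt0.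
have wz : z / q ^+ J <= z by rewrite ler_pdivrMr // ler_peMr.
have w0 : 0 <= z / q ^+ J by rewrite divr_ge0 ?(ltW qJ0).
apply: (le_trans (qln_norm_le _ _ q2 _)); first by rewrite w0 (le_lt_trans wz).
rewrite exprVn mulrAC ler_wpM2r ?invr_ge0 ?(ltW qJ0) // ler_wpM2l //.
rewrite lef_pV2 ?posrE ?subr_gt0 ?(le_lt_trans wz) //.
by rewrite lerD2l lerN2.
Qed.

(* The sum over [j >= 0] of [1 / (q ^ (n + j + 1) + l)]. *)
Definition recip_sum (R : realType) (q n l : nat) : R :=
  if l == 0%N then (q%:R ^+ n * (q%:R - 1))^-1
  else l%:R^-1 * qln q%:R (1 + l%:R / q%:R ^+ n).

(** For $l>0$ this is [qln_cvg] at $z=l/q^n$, divided by $l$; for $l=0$ the series is geometric. *)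
Lemma recip_sum_cvg {R : realType} q n l : (1 < q)%N -> (l < q ^ n)%N ->
  (fun J => \sum_(0 <= j < J) (q * q ^ (n + j) + l)%:R^-1 : R) @ \oo --> recip_sum R q n l.
Proof.
move=> q1 lq; have q0 : 0 < q%:R :> R by rewrite ltr0n ltnW.
have qn0 : 0 < q%:R ^+ n :> R by rewrite exprn_gt0.
have q1' : 1 < q%:R :> R by rewrite ltr1n.
rewrite /recip_sum; case: eqP => [->|/eqP l0].
  have nq : `|q%:R^-1| < 1 :> R by rewrite ger0_norm ?invr_ge0 // invf_lt1.
  have := @cvg_geometric_series R (q%:R ^- n.+1) _ nq.
  have -> : q%:R ^- n.+1 * (1 - q%:R^-1)^-1 = (q%:R ^+ n * (q%:R - 1))^-1 :> R.
    by rewrite exprS; field; rewrite !gt_eqF ?subr_gt0.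
  apply: cvg_trans; apply: near_eq_cvg; apply: nearW => J.
  rewrite /series /=; apply: eq_bigr => j _.
  by rewrite addn0 -expnS natrX -addSn exprD invfM exprVn.
have l0' : 0 < l%:R :> R by rewrite ltr0n lt0n.
have z01 : 0 <= (l%:R / q%:R ^+ n : R) < 1.
  by rewrite divr_ge0 ?(ltW qn0) //= ltr_pdivrMr // mul1r -natrX ltr_nat.
have q2 : 2 <= q%:R :> R by rewrite ler_nat.
apply: cvg_trans (cvgM (cvg_cst (l%:R^-1 : R)) (qln_cvg _ _ q2 z01)).
 apply: near_eq_cvg; apply: nearW => J /=.
rewrite /cst mulr_sumr; apply: eq_bigr => j _.
rewrite natrD -expnS natrX -addnS exprD.
have qj0 : 0 < q%:R ^+ j.+1 :> R by rewrite exprn_gt0.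
move: (q%:R ^+ j.+1) qj0 => X X0; field.
by rewrite !gt_eqF // addr_gt0 // mulr_gt0.
Qed.

(** * Summation over $M=q^k$ and identification with $A'$ and $L'$ *)

Lemma antider_ln_harm {R : realType} q M :
  antider_ln R q M = harm R (q * M) - harm R M - ln q%:R.
Proof.
rewrite /antider_ln /antider hornerD hornerN !horner_sum; congr (_ - _ - _);
by apply: eq_bigr => i _; rewrite hornerZ hornerXn expr1n mulr1.
Qed.

Lemma sum_antider_ln {R : realType} q n J : \sum_(0 <= j < J) antider_ln R q (q ^ (n + j)) =
  harm R (q ^ (n + J)) - harm R (q ^ n) - J%:R * ln q%:R.
Proof.
elim: J => [|J IHJ]; first by rewrite big_nil addn0 subrr mul0r subrr.
rewrite big_nat_recr //= IHJ antider_ln_harm -expnS -addnS -natr1.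
by move: (harm _ _) (harm _ _) (harm _ _) (ln _) => a b c d; ring.
Qed.

(** The harmonic parts telescope. In the correction the finite sum over $l$ is moved outside, so
    limits are taken for each $l$ separately. *)
Lemma sum_corrected_cvg {R : realType} m q n : (1 < q)%N -> (m * q.-1 <= q ^ n)%N ->
  (fun J => \sum_(0 <= j < J) ((corrected R m q (q ^ (n + j))).[1] - ln q%:R)) @ \oo -->
  euler_gamma R + n%:R * ln q%:R - harm R (q ^ n)
  + q%:R ^- m * \sum_(0 <= l < m * q.-1) (bcoef l m q)%:~R * recip_sum R q n l.
Proof.
move=> q1 mq.
have h2 : (fun J => \sum_(l < m * q.-1) (bcoef l m q)%:~R *
      \sum_(0 <= j < J) (q * q ^ (n + j) + l)%:R^-1 : R) @ \oo -->
    \sum_(l < m * q.-1) (bcoef l m q)%:~R * recip_sum R q n l.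
  apply: cvg_big => [|l _]; first exact: add_continuous.
  by apply: cvgMr; apply: recip_sum_cvg => //; apply: leq_trans mq.
rewrite big_mkord.
apply: cvg_trans (cvgD (cvgB (@harm_expn_cvg R q n q1) (cvg_cst (harm R (q ^ n))))
  (cvgM (cvg_cst (q%:R ^- m : R)) h2)).
 apply: near_eq_cvg; apply: nearW => J /=.
rewrite !fctE (eq_bigr _ (fun j _ => corrected1 m q (q ^ (n + j)))) big_split /=.
rewrite sum_antider_ln -mulr_sumr; congr (_ + _ * _).
  by rewrite addrAC.
under eq_bigr do rewrite mulr_sumr; rewrite exchange_big /=.
by under [in RHS]eq_bigr do rewrite big_mkord.
Qed.

(** Induction on $M$: the step adds $1/(qM)$ and all $1/(qM+\lambda)$ to the first sum and $1/M$ to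
    the second, and $1/M-1/(qM)=(q-1)/(qM)$. *)
Lemma harm_mul {R : realType} q M : (1 < q)%N -> (0 < M)%N ->
  harm R (q * M) - harm R M = \sum_(1 <= mu < q) mu%:R^-1
    - \sum_(1 <= mu < M) ((q%:R - 1) / (q%:R * mu%:R)
        - \sum_(1 <= lam < q) (q%:R * mu%:R + lam%:R)^-1).
Proof.
move=> q1; elim: M => // -[|M] IHM _.
  by rewrite muln1 /harm !(@big_geq _ _ _ 1 1) // !subr0.
have M0 : M.+1%:R != 0 :> R by rewrite pnatr_eq0.
have q0 : q%:R != 0 :> R by rewrite pnatr_eq0 -lt0n ltnW.
rewrite harmS // big_nat_recr //= [in RHS]opprD [in RHS]addrA -IHM // {IHM}.
have -> : harm R (q * M.+2) = harm R (q * M.+1) + (q%:R * M.+1%:R)^-1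
    + \sum_(1 <= lam < q) (q%:R * M.+1%:R + lam%:R)^-1.
  have qM : (1 <= q * M.+1)%N by rewrite muln_gt0 ltnW.
  rewrite /harm (@big_cat_nat _ _ _ (q * M.+1)) //=; last by rewrite leq_mul2l leqnSn orbT.
  rewrite -addrA; congr (_ + _).
  rewrite -{1}[(q * M.+1)%N]add0n big_addn [(q * M.+2)%N]mulnS addnK.
  rewrite big_ltn ?(ltnW q1) // add0n natrM; congr (_ + _).
  by apply: eq_bigr => i _; rewrite natrD natrM addrC.
have -> : (q%:R - 1) / (q%:R * M.+1%:R) = M.+1%:R^-1 - (q%:R * M.+1%:R)^-1 :> R.
  by rewrite mulrBl mul1r invfM mulrA divff // mul1r.
by move: (harm _ _) (harm _ _) (\sum_(_ <= _ < _) _) => a b c; ring.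
Qed.

(** Recognizes the large bracket of [Aprime]: it is [harm_mul] summed over $M=q^k$, $k<n$. *)
Lemma harm_expn {R : realType} q n : (1 < q)%N ->
  harm R (q ^ n) = \sum_(1 <= mu < q) n%:R / mu%:R
     - \sum_(2 <= nu < n.+1) \sum_(1 <= mu < q ^ nu.-1)
         ((q%:R - 1) / (q%:R * mu%:R)
          - \sum_(1 <= lam < q) (q%:R * mu%:R + lam%:R)^-1).
Proof.
move=> q1; rewrite -mulr_sumr.
(* Reindexing by $\nu=k+1$; the extra $k=0$ is harmless, its inner range being empty as $q^0=1$. *)
have -> : \sum_(2 <= nu < n.+1) \sum_(1 <= mu < q ^ nu.-1)
         ((q%:R - 1) / (q%:R * mu%:R)
          - \sum_(1 <= lam < q) (q%:R * mu%:R + lam%:R)^-1) =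
    \sum_(0 <= k < n) \sum_(1 <= mu < q ^ k)
         ((q%:R - 1) / (q%:R * mu%:R)
          - \sum_(1 <= lam < q) (q%:R * mu%:R + lam%:R)^-1) :> R.
  case: n => [|n]; first by rewrite !big_geq.
  by rewrite [RHS]big_ltn // [in RHS](@big_geq _ _ _ 1 (q ^ 0)) // add0r [LHS]big_add1.
elim: n => [|n IHn]; first by rewrite mul0r big_geq // subr0 /harm big_geq.
rewrite big_nat_recr //= -natr1 expnS -[LHS](subrK (harm R (q ^ n))).
rewrite harm_mul ?expn_gt0 ?(ltnW q1) // IHn.
by move: (\sum_(_ <= _ < _) _) (\sum_(_ <= _ < _) _) (\sum_(_ <= _ < _) _) => a b c; ring.
Qed.

Lemma bcoef0 {R : realType} m q : (0 < q)%N ->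
  (bcoef 0 m q)%:~R = (q%:R - 1) * ((q%:R - 1) ^+ m - q%:R ^+ m) :> R.
Proof.
move=> q0; have G0 : (GqR R q).[0] = q%:R - 1.
  have /(congr1 (horner^~ 0)) := @GqR_telescope R q q0.
  by rewrite -polyC_natr !hornerE FqR0 // subr0 mul1r.
have := bpoly_binomial m q; rewrite /bcoef; move: (bpoly m q) => B.
move=> /(congr1 (fun p => (map_poly (intr : int -> R) p).[0])).
rewrite !(rmorphD, rmorphM, rmorphXn, rmorphN, rmorph_nat) /= -/(FqR R q) -/(GqR R q).
rewrite !(hornerD, hornerM, horner_exp, hornerN) -polyC_natr !hornerC G0 FqR0 // mul1r.
rewrite horner_coef0 coef_map /= => E.
by rewrite mulrBr -E; ring.
Qed.

Lemma euler_gamma_remainder {R : realType} q n m : (1 < q)%N ->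
  euler_gamma R - (Aprime R n m q - Lprime R n m q) / q%:R ^+ m =
  euler_gamma R + n%:R * ln q%:R - harm R (q ^ n)
  + q%:R ^- m * \sum_(0 <= l < m * q.-1) (bcoef l m q)%:~R * recip_sum R q n l.
Proof.
move=> q1; have q0 := ltnW q1.
have q0' : q%:R != 0 :> R by rewrite pnatr_eq0 -lt0n.
have qB1 : q%:R - 1 != 0 :> R by rewrite subr_eq0 gt_eqF // ltr1n.
have qn0 : q%:R ^+ n != 0 :> R by rewrite expf_neq0.
have qm0 : q%:R ^+ m != 0 :> R by rewrite expf_neq0.
have -> : \sum_(0 <= l < m * q.-1) (bcoef l m q)%:~R * recip_sum R q n l =
    ((q%:R - 1) ^+ m - q%:R ^+ m) / q%:R ^+ n
    + \sum_(1 <= l < m * q.-1)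
      (bcoef l m q)%:~R / l%:R * qln q%:R (1 + l%:R / q%:R ^+ n).
  (* For $m=0$ there is no term $l=0$ to split off, but its closed form vanishes too. *)
  have [->|m0] := posnP m.
    by rewrite mul0n !big_geq // !expr0 subrr mul0r addr0.
  rewrite big_ltn ?muln_gt0 ?m0 -?subn1 ?subn_gt0 // bcoef0 //; congr (_ + _).
    by rewrite /recip_sum eqxx; field; rewrite qn0.
  apply: eq_big_nat => l /andP[l1 _].
  by rewrite /recip_sum gtn_eqF // mulrA.
rewrite /Aprime -harm_expn // /Lprime.
move: (\sum_(_ <= _ < _) _) (harm _ _) (ln _) (euler_gamma _) => S h L g.
by field; rewrite qn0.
Qed.

Theorem theorem9 (R : realType) (q n m : nat) (hq : (2 <= q)%N)
    (hm : m = ((q ^ n - 1) %/ (q - 1))%N) :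
  exists delta : R,
    [/\ euler_gamma R = (Aprime R n m q - Lprime R n m q) / q%:R ^+ m + delta,
        0 < delta
      & delta < q%:R / (2 * expR 1 * q%:R) ^+ m].
Proof.
have mq : (m * q.-1 = (q ^ n).-1)%N.
  by rewrite hm !subn1 predn_exp mulKn 1?mulnC // -subn1 subn_gt0.
have q0 : (0 < q)%N by exact: ltnW.
have lim_delta : (fun J => \sum_(0 <= j < J)
      ((corrected R m q (q ^ (n + j))).[1] - ln q%:R)) @ \oo -->
    euler_gamma R - (Aprime R n m q - Lprime R n m q) / q%:R ^+ m.
  by rewrite euler_gamma_remainder //; apply: sum_corrected_cvg => //; rewrite mq leq_pred.
exists (euler_gamma R - (Aprime R n m q - Lprime R n m q) / q%:R ^+ m); split.
- by rewrite addrC subrK.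
- apply: (lt_le_trans (corrected_gt0 m q (q ^ n) hq _)); first by rewrite expn_gt0 q0.
  (* All terms are positive, so the limit is at least the first one, which keeps the inequality
     strict. *)
  apply: (cvgr_to_ge lim_delta); exists 1%N => // J /= J1.
  rewrite big_ltn // addn0 lerDl; apply: sumr_ge0 => j _.
  by apply/ltW/corrected_gt0 => //; rewrite expn_gt0 q0.
set c := (2 * expR 1 * q%:R) ^+ m.
have c0 : 0 < c by rewrite exprn_gt0 // !mulr_gt0 ?expR_gt0 ?ltr0n.
(* The argument gives the sharper bound $(2eq)^{-m}$; strictness comes from $1<q$. *)
apply: (@le_lt_trans _ _ c^-1); last first.
  by rewrite ltr_pdivlMr // mulVf ?gt_eqF // ltr1n.
apply: (cvgr_to_le lim_delta); apply: nearW => J.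
apply: (@le_trans _ _ (\sum_(0 <= j < J) c^-1 * antider_ln R q (q ^ j))).
  by apply: ler_sum => j _; exact: corrected_le.
rewrite -mulr_sumr ler_piMr ?invr_ge0 ?(ltW c0) //.
(* With $n=0$ the sum telescopes to [harm R (q ^ J)] minus $\ln q^J$, at most $1$. *)
rewrite (@sum_antider_ln R q 0 J) expn0 [harm R 1]/harm big_geq // subr0 add0n.
by rewrite mulr_natl -lnXn ?ltr0n // -natrX harm_sub_ln_le1 // expn_gt0 q0.
Qed.
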